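(* For $n\in\mathbb{N}$ let $M_n$ be the random symmetric $n\times n$ matrix whose entries on and above the diagonal are independent Rademacher random variables. For every $\varepsilon>0$ there is $n_0=n_0(\varepsilon)$ such that for all integers $n\ge n_0$, $$\Pr\left(|\operatorname{per} M_n|\ge n^{n/2+\varepsilon n}\right)\le n^{-\varepsilon n}.$$
   Context: A Rademacher random variable takes the values $+1$ and $-1$ with probability $1/2$ each. The entries of $M_n$ below the diagonal are determined by symmetry. The permanent of an $n\times n$ matrix $M=(x_{i,j})$ is $\operatorname{per}(M)=\sum_{\pi\in S_n}\prod_{i=1}^n x_{i,\pi(i)}$. *)

(* Defs.v *)
From HB Require Import structures.
From mathcomp Require Import all_boot all_order all_algebra all_fingroup.
From mathcomp Require Import all_classical all_reals all_analysis.

Set Implicit Arguments.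
Unset Strict Implicit.
Unset Printing Implicit Defensive.

Import Order.TTheory GRing.Theory Num.Theory.

Local Open Scope classical_set_scope.
Local Open Scope ring_scope.

Definition permanent (R : comNzRingType) (n : nat) (M : 'M[R]_n) : R :=
  \sum_(s : 'S_n) \prod_(i < n) M i (s i).

Definition rademacher d (T : measurableType d) (R : realType)
    (P : probability T R) (X : {RV P >-> R}) : Prop :=
  P (X @^-1` [set 1]) = (2^-1)%:E /\ P (X @^-1` [set -1]) = (2^-1)%:E.

(* Mutual independence of the subfamily [X i], [i \in D]. *)
Definition mutually_independent d (T : measurableType d) (R : realType)
    (P : probability T R) (I : finType) (D : {set I})
    (X : I -> {RV P >-> R}) : Prop :=
  forall (J : {set I}) (B : I -> set R),
    J \subset D -> (forall i, i \in J -> measurable (B i)) ->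
    P (\bigcap_(i in [set` J]) (X i @^-1` B i))
      = (\prod_(i in J) P (X i @^-1` B i))%E.

Definition random_symmetric_rademacher d (T : measurableType d) (R : realType)
    (P : probability T R) (n : nat) (X : 'I_n -> 'I_n -> {RV P >-> R}) : Prop :=
  [/\ forall i j w, X i j w = X j i w,
      forall i j : 'I_n, (i <= j)%N -> rademacher (X i j)
    & mutually_independent [set p : 'I_n * 'I_n | (p.1 <= p.2)%N]%SET
        (fun p => X p.1 p.2)].

Definition matrix_of_entries d (T : measurableType d) (R : realType)
    (P : probability T R) (n : nat) (X : 'I_n -> 'I_n -> {RV P >-> R})
    (w : T) : 'M[R]_n :=
  \matrix_(i, j) X i j w.

(* Main.v *)
Require Import Defs.
From HB Require Import structures.
From mathcomp Require Import all_boot all_order all_algebra all_fingroup.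
From mathcomp Require Import all_classical all_reals all_analysis.
From mathcomp Require Import zify ring lra.

(** Second moment method.  Expanding the square, [E (per M)^2] is the number of
    pairs [(pi, sigma)] of permutations such that every edge [{i, j}] occurs an
    even number of times among the [2n] edges [{i, pi i}], [{i, sigma i}].  The
    set [E] of edges used by such a pair has at most [n] elements and at most
    two edges at each vertex.  There are at most [(n+1) n^(2n) / n!] choices of
    [E], and given [E] at most [2^n] choices for each of [pi] and [sigma];
    hence [E (per M)^2 <= 32^n n^n], and Markov's inequality gives a bound
    [32^n n^(-2 eps n)], which suffices once [n^eps >= 32].  Expectations are
    computed as finite averages over the sign patterns of the entries. *)

Set Implicit Arguments.
Unset Strict Implicit.
Unset Printing Implicit Defensive.

Import Order.TTheory GRing.Theory Num.Theory.

(** * Counting inequalities *)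

(* [n ^ n <= (2n) ^_ n = 'C(2n, n) * n`!] *)
Lemma leq_expn_fact n : n ^ n <= 4 ^ n * n`!.
Proof.
have bin_le : 'C(n + n, n) <= 4 ^ n.
  have -> : 4 ^ n = \sum_(i < (n + n).+1) 'C(n + n, i).
    rewrite -[4]/(2 ^ 2) -expnM mul2n -addnn -[2]/(1 + 1) expnDn.
    by apply: eq_bigr => i _; rewrite !exp1n !muln1.
  by rewrite (bigD1 (inord n)) //= inordK ?leq_addr // ltnS leq_addr.
apply: leq_trans (leq_mul bin_le (leqnn _)).
rewrite bin_ffact ffact_prod -[X in _ ^ X]card_ord -prod_nat_const.
by apply: leq_prod => i _; have := ltn_ord i; lia.
Qed.

(** For each size [k <= n], writing [n! = n ^_ (n - k) * k!] bounds [n! * 'C(#|T|, k)] by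
    [n ^ (n - k) * #|T| ^ k], hence by [#|T| ^ n]. There are [n.+1] sizes. *)
Lemma card_subsets_leq (T : finType) n : n <= #|T| ->
  n`! * #|[set A : {set T} | #|A| <= n]%SET| <= n.+1 * #|T| ^ n.
Proof.
move=> nT.
have -> : #|[set A : {set T} | #|A| <= n]%SET| = \sum_(k < n.+1) 'C(#|T|, k).
  rewrite -sum1_card (partition_big (fun A : {set T} => inord #|A| : 'I_n.+1)
    predT) //=.
  apply: eq_bigr => k _; rewrite sum1dep_card -card_draws.
  apply: eq_card => A; rewrite !inE.
  have := ltn_ord k; rewrite ltnS => kn.
  apply/andP/eqP => [[An /eqP <-]|Ak]; first by rewrite inordK.
  by rewrite Ak kn; split=> //; apply/eqP/val_inj; rewrite /= inordK.
rewrite big_distrr /= -[in leqRHS](card_ord n.+1) -sum_nat_const.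
apply: leq_sum => k _; have := ltn_ord k; rewrite ltnS => kn.
have -> : n`! = n ^_ (n - k) * k`!.
  by rewrite -{2}(subKn kn) ffact_fact ?leq_subr.
rewrite -mulnA mulnC [k`! * _]mulnC bin_ffact -[X in _ <= _ ^ X](subnKC kn) expnD.
have ffact_leX m l : m ^_ l <= m ^ l.
  rewrite ffact_prod -[X in _ ^ X]card_ord -prod_nat_const.
  by apply: leq_prod => i _; apply: leq_subr.
apply: leq_mul (ffact_leX _ _) _; apply: leq_trans (ffact_leX _ _) _.
by case: (n - k) => // m; rewrite leq_exp2r.
Qed.

(** Count the pairs [(j, x)] with [j] in [A] and [e x = h j]: each [j] has at least two, each [x] at
    most one as [h] is injective, and only [x] in [B] occur. *)
Lemma double_count_fibers (I J V : finType) (e : I -> V) (h : J -> V)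
    (A : {set J}) (B : {set I}) : injective h ->
  (forall j, j \in A -> 1 < #|[set x | e x == h j]%SET|) ->
  (forall j x, j \in A -> e x = h j -> x \in B) ->
  #|A|.*2 <= #|B|.
Proof.
move=> h_inj fib2 fibB.
rewrite -muln2 -sum_nat_const.
apply: leq_trans (_ : \sum_(j in A) \sum_(x in B) (e x == h j) <= _).
  apply: leq_sum => j jA; apply: leq_trans (fib2 j jA) _.
  rewrite -sum1dep_card big_mkcond [leqRHS]big_mkcond /=.
  apply: leq_sum => x _; case: eqP => // ex.
  by rewrite (fibB _ _ jA ex).
rewrite exchange_big /= -sum1_card; apply: leq_sum => x _.
case: (pickP [pred j in A | e x == h j]) => [j /andP[jA /eqP ex]|none].
  rewrite (bigD1 j) //= ex eqxx big1 // => k /andP[_ kj].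
  by rewrite (inj_eq h_inj) eq_sym (negbTE kj).
by rewrite big1 // => j jA; have := none j; rewrite /= jA /= => ->.
Qed.

(** * Even pairs of permutations and their edges *)

(** Unordered pairs, loops included, are put in increasing order, so that an edge is the index of an
    independent entry. *)
Definition edge n (i j : 'I_n) : 'I_n * 'I_n :=
  if i <= j then (i, j) else (j, i).

Lemma edge_leq n (i j : 'I_n) : (edge i j).1 <= (edge i j).2.
Proof. by rewrite /edge; case: (leqP i j) => /= [|/ltnW]. Qed.

Lemma edgeE n (i j k l : 'I_n) : edge i j = edge k l ->
  (i = k /\ j = l) \/ (i = l /\ j = k).
Proof. by rewrite /edge; do 2!case: ifP => _; case=> -> ->; auto. Qed.

Lemma edge_inj n (i : 'I_n) : injective (edge i).
Proof. by move=> j k /edgeE [[_ ->]|[-> ->]]. Qed.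

Definition pair_edge n (u : 'S_n * 'S_n) (x : 'I_n * bool) : 'I_n * 'I_n :=
  edge x.1 (if x.2 then u.1 x.1 else u.2 x.1).

Definition multiplicity n (u : 'S_n * 'S_n) (p : 'I_n * 'I_n) : nat :=
  #|[set x | pair_edge u x == p]%SET|.

(** Exactly the pairs whose product of entries has mean 1; for every other pair the mean is 0. *)
Definition even_pairs n : {set 'S_n * 'S_n} :=
  [set u | [forall p, ~~ odd (multiplicity u p)]]%SET.

Definition edge_set n (u : 'S_n * 'S_n) : {set 'I_n * 'I_n} :=
  [set pair_edge u x | x in [set: 'I_n * bool]]%SET.

Lemma multiplicity_gt1 n (u : 'S_n * 'S_n) p :
  u \in even_pairs n -> p \in edge_set u -> 1 < multiplicity u p.
Proof.
rewrite inE => /forallP/(_ p) ev /imsetP[x _ px].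
have : 0 < multiplicity u p by apply/card_gt0P; exists x; rewrite inE px.
by case: multiplicity ev => [|[|]].
Qed.

Lemma card_edge_set n (u : 'S_n * 'S_n) :
  u \in even_pairs n -> #|edge_set u| <= n.
Proof.
move=> uev; rewrite -leq_double.
have -> : n.*2 = #|[set: 'I_n * bool]%SET|.
  by rewrite cardsT card_prod card_ord card_bool muln2.
apply: (@double_count_fibers _ _ _ (pair_edge u) id) => //.
by move=> p; apply: multiplicity_gt1.
Qed.

Definition neighbours n (E : {set 'I_n * 'I_n}) (v : 'I_n) : {set 'I_n} :=
  [set j | edge v j \in E]%SET.

(* An even pair has at most four half-edges at [v], hence two neighbours. *)
Lemma card_neighbours n (u : 'S_n * 'S_n) v :
  u \in even_pairs n -> #|neighbours (edge_set u) v| <= 2.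
Proof.
move=> uev; rewrite -leq_double.
(* Only these indices can give an edge at [v]: for each permutation, [v] itself and the preimage of
   [v]. *)
pose B := [set (v, true); (v, false); ((u.1^-1)%g v, true);
               ((u.2^-1)%g v, false)]%SET.
apply: (@leq_trans #|B|).
  apply: (@double_count_fibers _ _ _ (pair_edge u) (edge v)).
  - exact: edge_inj.
  - by move=> j; rewrite inE => /(multiplicity_gt1 uev).
  - move=> j [i b] _ /edgeE /= []; rewrite !inE !xpair_eqE.
      by move=> [-> _]; rewrite !eqxx; case: b.
    by move=> [_ <-]; case: b; rewrite permK !eqxx /= ?orbT.
by do 3!(apply: leq_trans (leq_card_setU _ _) _; rewrite !cards1 addn1 ltnS).
Qed.

Lemma card_perm_family_leq (T : finType) (F : T -> {set T}) :
  #|[set s : {perm T} | [forall v, s v \in F v]]%SET| <= \prod_v #|F v|.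
Proof.
have -> : \prod_v #|F v| = #|family (fun v => mem (F v))|.
  by rewrite card_family foldrE big_map big_enum.
rewrite -(card_imset _ (val_inj : injective (@pval T))).
apply: subset_leq_card; apply/fintype.subsetP => f /imsetP[s].
rewrite inE => /forallP sF ->; apply/familyP => v.
by have := sF v; rewrite pvalE.
Qed.

Lemma card_even_pairs_edge_set n (E : {set 'I_n * 'I_n}) :
  #|[set u in even_pairs n | edge_set u == E]%SET| <= 4 ^ n.
Proof.
(* The bound on [neighbours E v] needs some even pair [u0] with edge set [E]; without one the count
   is zero. *)
have [->|[u0]] := set_0Vmem [set u in even_pairs n | edge_set u == E]%SET.
  by rewrite cards0.
rewrite inE => /andP[u0ev /eqP u0E].
pose S := [set s : 'S_n | [forall v, s v \in neighbours E v]]%SET.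
have cS : #|S| <= 2 ^ n.
  apply: leq_trans (card_perm_family_leq _) _.
  rewrite -[X in _ ^ X]card_ord -prod_nat_const.
  by apply: leq_prod => v _; rewrite -u0E card_neighbours.
apply: (@leq_trans #|finset.setX S S|); last first.
  by rewrite cardsX -[4]/(2 * 2) expnMn leq_mul.
apply: subset_leq_card; apply/fintype.subsetP => -[s t].
rewrite !inE => /andP[_ /eqP <-]; apply/andP; split; apply/forallP => v.
  by rewrite inE; apply/imsetP; exists (v, true); rewrite ?inE.
by rewrite inE; apply/imsetP; exists (v, false); rewrite ?inE.
Qed.

Lemma card_even_pairs n : #|even_pairs n| <= 32 ^ n * n ^ n.
Proof.
have le1 : #|even_pairs n| <=
    #|[set A : {set 'I_n * 'I_n} | #|A| <= n]%SET| * 4 ^ n.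
  rewrite -sum1_card -sum_nat_const.
  rewrite (partition_big (@edge_set n)
    (fun E => E \in [set A : {set 'I_n * 'I_n} | #|A| <= n]%SET)) /=; last first.
    by move=> u uev; rewrite inE card_edge_set.
  apply: leq_sum => E _; rewrite sum1dep_card.
  exact: card_even_pairs_edge_set.
have le2 := @card_subsets_leq ('I_n * 'I_n)%type n.
rewrite card_prod !card_ord in le2.
have {}le2 : n`! * #|[set A : {set 'I_n * 'I_n} | #|A| <= n]%SET| <=
    n.+1 * (n * n) ^ n.
  by apply: le2; case: (n) => // m; rewrite leq_pmulr.
have le3 := leq_expn_fact n.
have le4 : n.+1 <= 2 ^ n by apply: ltn_expl.
have fn0 := fact_gt0 n.
rewrite -(leq_pmul2l fn0).
apply: leq_trans (leq_mul (leqnn _) le1) _.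
rewrite mulnA; apply: leq_trans (leq_mul le2 (leqnn _)) _.
rewrite expnMn.
(* Here [2 ^ n] bounds [n.+1], the first [4 ^ n] pays for trading one [n ^ n] for [n!], which then
   cancels, and the last counts the pairs with a given edge set. *)
apply: (@leq_trans (2 ^ n * (n ^ n * (4 ^ n * n`!)) * 4 ^ n)).
  by rewrite leq_mul // leq_mul // leq_mul.
rewrite -[32]/(2 * 4 * 4) !expnMn.
by apply: eq_leq; ring.
Qed.

Local Open Scope classical_set_scope.
Local Open Scope ring_scope.

(** * Probabilities by counting sign patterns *)

Lemma measure_fin_subadditive d (T : measurableType d) (R : realType)
    (mu : {measure set T -> \bar R}) (I : finType) (Q : {set I}) (A : I -> set T) :
  (forall i, measurable (A i)) ->
  (mu (\bigcup_(i in [set` Q]) A i) <= \sum_(i in Q) mu (A i))%E.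
Proof.
move=> mA; rewrite bigcup_pred.
(* Measurability is carried along because binary subadditivity requires it. *)
pose K (B : set T) (x : \bar R) := measurable B /\ (mu B <= x)%E.
suff [] : K (\big[setU/set0]_(i in Q) A i) (\sum_(i in Q) mu (A i))%E by [].
elim/big_ind2: _ => [|B x C y [mB Bx] [mC Cy]|i _].
- by split; rewrite ?measure0.
- split; first exact: measurableU.
  by apply: (le_trans (measureU2 mu mB mC)); exact: leeD.
- by split.
Qed.

Section RademacherFamily.
Variables (d : measure_display) (T : measurableType d) (R : realType).
Variables (P : probability T R) (I : finType) (D : {set I}).
Variable X : I -> {RV P >-> R}.
Hypothesis radX : forall i, i \in D -> rademacher (X i).
Hypothesis indX : mutually_independent D X.

(* [S] is the set of indices in [D] at which the sign is [-1]. *)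
Definition sign_event (S : {set I}) : set T :=
  \bigcap_(i in [set` D]) (X i @^-1` [set (-1) ^+ (i \in S)]).

Lemma measurable_preimage1 i (x : R) : measurable (X i @^-1` [set x]).
Proof. by apply: measurable_funPTI; exact: measurable_set1. Qed.

Lemma measurable_sign_event S : measurable (sign_event S).
Proof.
apply: fin_bigcap_measurable => // i _; exact: measurable_preimage1.
Qed.

Lemma probability_sign_event S : P (sign_event S) = ((2 ^- #|D|)%:E)%E.
Proof.
rewrite indX //.
rewrite (eq_bigr (fun=> (2^-1)%:E)); last first.
  by move=> i /radX [r1 r2]; case: (i \in S); rewrite ?expr0 ?expr1.
by rewrite prodEFin prodr_const exprVn.
Qed.

(** A variable with the Rademacher law may still take other values on a null set, which has to be
    split off. *)
Definition non_sign_event i : set T :=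
  ~` (X i @^-1` [set 1] `|` X i @^-1` [set -1]).

Lemma probability_non_sign_event i : i \in D -> P (non_sign_event i) = 0%E.
Proof.
have neq : 1 <> -1 :> R by lra.
move=> /radX [r1 r2].
have m1 := measurable_preimage1 i 1; have m2 := measurable_preimage1 i (-1).
rewrite probability_setC; last exact: measurableU.
rewrite measureU //=; last first.
  by rewrite -preimage_setI; apply/seteqP; split => w //= [-> /neq].
rewrite r1 r2 -EFinD.
by apply/eqP; rewrite eqe; apply/eqP; lra.
Qed.

(** Up to a null event, [E] is covered by the sign events of the patterns in [good], each of
    probability [2 ^- #|D|]; the union bound concludes. *)
Lemma rademacher_probability_le (E : set T) (good : {set {set I}}) :
  measurable E ->
  (forall (S : {set I}) w, (S \subset D)%SET -> E w -> sign_event S w -> S \in good) ->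
  (P E <= (#|good|%:R * 2 ^- #|D|)%:E)%E.
Proof.
move=> mE goodE.
pose U := \bigcup_(S in [set` good]) sign_event S.
pose N := \bigcup_(i in [set` D]) non_sign_event i.
have mN i : measurable (non_sign_event i).
  by apply: measurableC; apply: measurableU; exact: measurable_preimage1.
have mU : measurable U.
  by apply: fin_bigcup_measurable => // S _; exact: measurable_sign_event.
have mNN : measurable N by apply: fin_bigcup_measurable => // i _; exact: mN.
have EUN : E `<=` U `|` N.
  move=> w Ew; have [wN|wN] := pselect (N w); [by right|left].
  have sgn i : i \in D -> X i w = (-1) ^+ (X i w == -1).
    move=> iD; have [->//|/eqP ne] := eqVneq; rewrite expr0.
    by apply: contrapT => ne1; apply: wN; exists i => // -[].
  pose S := [set i in D | X i w == -1]%SET.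
  have SD : (S \subset D)%SET by apply/fintype.subsetP => i; rewrite inE => /andP[].
  have wS : sign_event S w.
    by move=> i /= iD; rewrite !inE iD /=; exact: sgn.
  by exists S => //=; exact: goodE wS.
apply: (@le_trans _ _ (P (U `|` N))).
  by apply: le_measure; rewrite ?inE //; exact: measurableU.
apply: (le_trans (measureU2 P mU mNN)).
have PN : (P N <= 0)%E.
  apply: le_trans (measure_fin_subadditive _ _ mN) _.
  by rewrite big1 // => i iD; exact: probability_non_sign_event.
rewrite -[leRHS]adde0; apply: leeD => //.
apply: le_trans (measure_fin_subadditive _ _ measurable_sign_event) _.
rewrite (eq_bigr (fun=> (2 ^- #|D|)%:E)); last first.
  by move=> S _; exact: probability_sign_event.
by rewrite sumEFin lee_fin sumr_const [leRHS]mulr_natl.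
Qed.

End RademacherFamily.

(** * The second moment as a sum over sign patterns *)

Lemma prod_add1_subsets (R : comNzRingType) (I : finType) (D : {set I})
    (F : I -> R) :
  \prod_(i in D) (1 + F i) =
  \sum_(S : {set I} | (S \subset D)%SET) \prod_(i in S) F i.
Proof.
rewrite big_mkcond /=.
rewrite (eq_bigr (fun i => (if i \in D then F i else 0) + 1)); last first.
  by move=> i _; case: ifP => _; rewrite ?add0r // addrC.
rewrite bigA_distr /= [RHS]big_mkcond /=; apply: eq_bigr => S _.
case: ifPn => [/fintype.subsetP SD|/fintype.subsetPn[i iS iD]].
  rewrite [RHS]big_mkcond /=; apply: eq_bigr => i _.
  by case: ifP => // /SD ->.
by rewrite (bigD1 i) //= iS (negbTE iD) mul0r.
Qed.

(** The sum factors as the product of [1 + (-1) ^+ m i] over [D], and each factor is 2 or 0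
    according to the parity of [m i]. *)
Lemma sum_subsets_sign (R : comNzRingType) (I : finType) (D : {set I})
    (m : I -> nat) :
  \sum_(S : {set I} | (S \subset D)%SET) \prod_(i in S) (-1) ^+ m i =
  (if [forall i in D, ~~ odd (m i)] then 2 ^+ #|D| else 0) :> R.
Proof.
rewrite -prod_add1_subsets; case: ifPn => [/forall_inP ev|].
  rewrite -prodr_const; apply: eq_bigr => i /ev /negbTE odd_mi.
  by rewrite -signr_odd odd_mi expr0.
rewrite negb_forall_in => /exists_inP[i iD]; rewrite negbK => odd_mi.
by rewrite (bigD1 i) //= -signr_odd odd_mi expr1 subrr mul0r.
Qed.

Definition upper n : {set 'I_n * 'I_n} :=
  [set p : 'I_n * 'I_n | (p.1 <= p.2)%N]%SET.

Definition sign_matrix (R : comNzRingType) n (S : {set 'I_n * 'I_n}) : 'M[R]_n :=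
  \matrix_(i, j) (-1) ^+ (edge i j \in S).

(** Both sides are -1 to the number of indices [x] whose edge lies in [S]; the right side groups
    these indices by edge. *)
Lemma prod_sign_matrix (R : comNzRingType) n (S : {set 'I_n * 'I_n})
    (u : 'S_n * 'S_n) :
  (\prod_i sign_matrix R S i (u.1 i)) * (\prod_i sign_matrix R S i (u.2 i)) =
  \prod_(p in S) (-1) ^+ multiplicity u p.
Proof.
have -> : (\prod_i sign_matrix R S i (u.1 i)) *
    (\prod_i sign_matrix R S i (u.2 i)) =
    \prod_(x : 'I_n * bool) (-1) ^+ (pair_edge u x \in S).
  rewrite -big_split /= -(pair_bigA _ (fun i b => (-1) ^+ (pair_edge u (i, b) \in S))).
  by apply: eq_bigr => i _; rewrite big_bool /= !mxE.
rewrite !prodrXr; congr (_ ^+ _).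
rewrite [RHS](eq_bigr (fun p => \sum_x (pair_edge u x == p))%N); last first.
  by move=> p _; rewrite /multiplicity -sum1dep_card big_mkcond.
rewrite exchange_big /=; apply: eq_bigr => x _.
case: (boolP (pair_edge u x \in S)) => [xS|xS].
  rewrite (bigD1 (pair_edge u x)) //= eqxx big1 // => p /andP[_ np].
  by rewrite eq_sym (negbTE np).
rewrite big1 // => p pS; case: eqP => // e.
by rewrite e pS in xS.
Qed.

(** Expand the square over pairs of permutations and sum over [S] first: an even pair contributes
    [2 ^+ #|upper n|], any other pair cancels out. *)
Lemma second_moment_permanent (R : comNzRingType) n :
  \sum_(S : {set 'I_n * 'I_n} | (S \subset upper n)%SET)
     permanent (sign_matrix R S) ^+ 2 =
  #|even_pairs n|%:R * 2 ^+ #|upper n|.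
Proof.
under eq_bigr => S _.
  rewrite expr2 /permanent big_distrlr /= pair_bigA /=.
  under eq_bigr do rewrite prod_sign_matrix.
  over.
rewrite exchange_big /= mulr_natl -sumr_const [RHS]big_mkcond /=.
apply: eq_bigr => u _; rewrite sum_subsets_sign inE; congr (if _ then _ else _).
apply/forall_inP/forallP => [ev p|ev p _]; last exact: ev.
(* Edges lie in [upper n], so multiplicities vanish elsewhere and the parity condition there is
   automatic. *)
have [|pU] := boolP (p \in upper n); first exact: ev.
rewrite /multiplicity; have -> : [set x | pair_edge u x == p]%SET = finset.set0.
  apply/setP => x; rewrite !inE; apply: contraNF pU => /eqP <-.
  by rewrite inE edge_leq.
by rewrite cards0.
Qed.

(** * Markov's inequality and the final estimate *)

Lemma measurable_permanent d (T : measurableType d) (R : realType)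
    (P : probability T R) n (X : 'I_n -> 'I_n -> {RV P >-> R}) :
  measurable_fun setT (fun w => permanent (matrix_of_entries X w)).
Proof.
rewrite /permanent; apply: measurable_sum => s.
apply: measurable_prod => i _.
rewrite (_ : (fun _ => _) = X i (s i)); first exact: measurable_funPT.
by apply/funext => w; rewrite mxE.
Qed.

Lemma probability_permanent_ge d (T : measurableType d) (R : realType)
    (P : probability T R) n (X : 'I_n -> 'I_n -> {RV P >-> R}) (t : R) :
  0 < t -> random_symmetric_rademacher X ->
  (P [set w | (t <= `|permanent (matrix_of_entries X w)|)%R]
     <= (#|even_pairs n|%:R / t ^+ 2)%:E)%E.
Proof.
move=> t0 [symX radX indX].
pose good := [set S : {set 'I_n * 'I_n} |
  (S \subset upper n)%SET && (t <= `|permanent (sign_matrix R S)|)]%SET.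
apply: (@le_trans _ _ (#|good|%:R * 2 ^- #|upper n|)%:E).
  apply: (@rademacher_probability_le _ _ _ _ _ _ (fun p => X p.1 p.2)) => //.
  - by move=> [i j]; rewrite inE => /radX.
  - have mf : measurable_fun setT (fun w => `|permanent (matrix_of_entries X w)|).
      by apply: measurableT_comp => //; exact: measurable_permanent.
    have := mf measurableT _ (measurable_itv `[t, +oo[).
    rewrite setTI; congr measurable; apply/funext => w /=.
    by rewrite in_itv /= andbT.
  - move=> S w SU tw Sw; rewrite inE SU /=.
    suff <- : matrix_of_entries X w = sign_matrix R S by [].
    apply/matrixP => i j; rewrite !mxE.
    (* The sign event fixes the entries on and above the diagonal; symmetry gives the others. *)
    have Xedge (k l : 'I_n) : (k <= l)%N -> X k l w = (-1) ^+ ((k, l) \in S).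
      by move=> kl; apply: (Sw (k, l)); rewrite /= inE.
    rewrite /edge; case: ifPn => [|]; first exact: Xedge.
    by rewrite -ltnNge => /ltnW/Xedge <-; rewrite symX.
(* Markov's inequality for the finite average: after clearing denominators, each good pattern
   contributes at least [t ^+ 2] to the sum of squares, and the other terms are nonnegative. *)
rewrite lee_fin ler_pdivlMr ?exprn_gt0 // mulrAC ler_pdivrMr ?exprn_gt0 //.
rewrite -second_moment_permanent mulr_natl -sumr_const.
rewrite [leRHS](bigID (mem good)) /= -[leLHS]addr0; apply: lerD; last first.
  by apply: sumr_ge0 => S _; exact: sqr_ge0.
rewrite [leRHS](eq_bigl (fun S => S \in good)) => [|S]; last first.
  by rewrite /= inE; case: (S \subset _).
apply: ler_sum => S; rewrite inE => /andP[_ tS].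
by rewrite -[leRHS]real_normK ?num_real // lerXn2r // ?nnegrE // ltW.
Qed.

Theorem proposition1p2 (R : realType) (eps : R) (heps : 0 < eps) :
  exists n0 : nat, forall n : nat, (n0 <= n)%N ->
  forall (d : measure_display) (T : measurableType d) (P : probability T R)
         (X : 'I_n -> 'I_n -> {RV P >-> R}),
    random_symmetric_rademacher X ->
    (P [set w | (n%:R `^ (n%:R / 2 + eps * n%:R)
                   <= `|permanent (matrix_of_entries X w)|)%R]
       <= (n%:R `^ (- (eps * n%:R)))%:E)%E.
Proof.
(* This makes [n] exceed [32 ^ (1 / eps)], so that [n ^ eps >= 32]; the successor ensures
   [n > 0]. *)
exists (Num.bound (32 `^ eps^-1)).+1 => n n0n d T P X rX.
have n_gt0 : 0 < n%:R :> R by rewrite ltr0n (leq_trans _ n0n).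
set a := n%:R `^ (eps * n%:R).
have a0 : 0 < a by apply: powR_gt0.
have a32 : 32 ^+ n <= a.
  rewrite /a powRrM powR_mulrn ?powR_ge0 // lerXn2r ?nnegrE ?powR_ge0 //.
  have -> : 32 = (32 `^ eps^-1) `^ eps :> R.
    by rewrite -powRrM mulVf ?gt_eqF // powRr1.
  apply: ge0_ler_powR; rewrite ?nnegrE ?powR_ge0 ?ltW //.
  apply: lt_le_trans (archi_boundP (powR_ge0 _ _)) _.
  by rewrite ler_nat ltnW.
(* With this square of the threshold, the bound becomes [32 ^ n * n ^ n / (n ^ n * a ^ 2)], which is
   at most [1 / a] since [32 ^ n <= a]. *)
have tE : (n%:R `^ (n%:R / 2 + eps * n%:R)) ^+ 2 = n%:R ^+ n * a ^+ 2 :> R.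
  rewrite powRD; last by rewrite (gt_eqF n_gt0) implybT.
  rewrite exprMn -(powR_mulrn 2 (powR_ge0 _ (n%:R / 2))) -powRrM.
  by rewrite divfK // powR_mulrn // ltW.
apply: le_trans (probability_permanent_ge _ rX) _; first exact: powR_gt0.
rewrite lee_fin tE powRN -/a ler_pdivrMr ?mulr_gt0 ?exprn_gt0 //.
have -> : a^-1 * (n%:R ^+ n * a ^+ 2) = a * n%:R ^+ n by field; rewrite gt_eqF.
apply: (@le_trans _ _ (32 ^+ n * n%:R ^+ n)).
  by rewrite -!natrX -natrM ler_nat card_even_pairs.
by rewrite ler_wpM2r // exprn_ge0 // ltW.
Qed.
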